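(* Let $\mathcal{E}_t$ and $\mathcal{D}_t$ be the series of flows and of small flows on rooted trees, and let $\mathcal{D}$ be the value of $\mathcal{D}_t$ at $t=0$. Then $$\mathcal{E}_t=\frac{1}{1-t}\mathcal{D}_t+\frac{b}{t}\left(\mathcal{D}_t-\mathcal{D}\right).$$
   Context: A rooted tree $T$ is a finite tree with a distinguished vertex (the root), edges oriented towards the root; $w\to v$ means that $w$ is a child of $v$. A flow on $T$ of size $k$ is a set $O$ of $k$ vertices (outputs) and a function $m:V(T)\to\mathbb{N}$ vanishing on $O$ (inputs with multiplicity are the vertices with $m>0$) such that the rates $r(v)\in\mathbb{Z}$ determined by $r(v)=m(v)-[v\in O]+\sum_{w\to v}r(w)$ are all $\ge 0$. The exit rate is $r(\mathrm{root})$. A flow is small if the root is neither an output nor an input. Let $\mathcal{E}_{T,t}=\sum b^{\text{size}}t^{\text{exit rate}}\in\mathbb{Q}[b][[t]]$ over all flows on $T$, $\mathcal{D}_{T,t}$ the same sum over all small flows on $T$, and $\mathcal{E}_t=\sum_T\mathcal{E}_{T,t}\,T/\mathrm{aut}(T)$, $\mathcal{D}_t=\sum_T\mathcal{D}_{T,t}\,T/\mathrm{aut}(T)$, formal sums over isomorphism classes of rooted trees, $\mathrm{aut}(T)$ being the number of automorphisms of $T$. *)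

(* Defs.v *)
From HB Require Import structures.
From mathcomp Require Import all_boot all_order all_algebra zify.
From mathcomp Require Import boolp classical_sets functions cardinality fsbigop.

Set Implicit Arguments.
Unset Strict Implicit.
Unset Printing Implicit Defensive.

Import Order.TTheory GRing.Theory Num.Theory.
Local Open Scope ring_scope.
Local Open Scope quotient_scope.

Record fps (R : Type) := FPS { fps_coef :> nat -> R }.

Lemma fpsP (R : Type) (f g : fps R) : (forall n, f n = g n) -> f = g.
Proof. by case: f g => [f] [g] /= /funext->. Qed.

HB.instance Definition _ (R : Type) := gen_eqMixin (fps R).
HB.instance Definition _ (R : Type) := gen_choiceMixin (fps R).

Section FpsRing.
Variable R : comNzRingType.
Implicit Types f g h : fps R.

Definition fps_zero : fps R := FPS (fun=> 0).
Definition fps_opp f : fps R := FPS (fun n => - f n).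
Definition fps_add f g : fps R := FPS (fun n => f n + g n).

Definition fpsC (c : R) : fps R := FPS (fun n => if n is 0 then c else 0).

Definition fpsX : fps R := FPS (fun n => (n == 1)%:R).

Definition fps_mul f g : fps R :=
  FPS (fun n => \sum_(i < n.+1) f i * g (n - i)%N).

Lemma fps_addA : associative fps_add.
Proof. by move=> f g h; apply: fpsP => n /=; rewrite addrA. Qed.

Lemma fps_addC : commutative fps_add.
Proof. by move=> f g; apply: fpsP => n /=; rewrite addrC. Qed.

Lemma fps_add0 : left_id fps_zero fps_add.
Proof. by move=> f; apply: fpsP => n /=; rewrite add0r. Qed.

Lemma fps_addN : left_inverse fps_zero fps_opp fps_add.
Proof. by move=> f; apply: fpsP => n /=; rewrite addNr. Qed.

HB.instance Definition _ :=
  GRing.isZmodule.Build (fps R) fps_addA fps_addC fps_add0 fps_addN.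

Definition fps_trunc n f : {poly R} := \poly_(i < n.+1) f i.

Lemma coef_fps_trunc n f k : (k <= n)%N -> (fps_trunc n f)`_k = f k.
Proof. by move=> kn; rewrite coef_poly ltnS kn. Qed.

Lemma coefM_fps n (p q : {poly R}) f g :
    (forall k, (k <= n)%N -> p`_k = f k) ->
    (forall k, (k <= n)%N -> q`_k = g k) ->
  forall k, (k <= n)%N -> (p * q)`_k = fps_mul f g k.
Proof.
move=> pf qg k kn; rewrite coefM /=; apply: eq_bigr => i _.
by rewrite pf ?qg // (leq_trans _ kn) ?leq_subr // -ltnS.
Qed.

Lemma fps_mulC : commutative fps_mul.
Proof.
move=> f g; apply: fpsP => n.
have Tn h k : (k <= n)%N -> (fps_trunc n h)`_k = h k by exact: coef_fps_trunc.
by rewrite -(coefM_fps (Tn f) (Tn g)) // mulrC (coefM_fps (Tn g) (Tn f)).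
Qed.

Lemma fps_mulA : associative fps_mul.
Proof.
move=> f g h; apply: fpsP => n.
have Tn u k : (k <= n)%N -> (fps_trunc n u)`_k = u k by exact: coef_fps_trunc.
rewrite -(coefM_fps (Tn f) (coefM_fps (Tn g) (Tn h))) // mulrA.
exact: (coefM_fps (coefM_fps (Tn f) (Tn g)) (Tn h)).
Qed.

Lemma fps_mul1 : left_id (fpsC 1) fps_mul.
Proof.
move=> f; apply: fpsP => n /=.
rewrite big_ord_recl /= mul1r subn0 big1 ?addr0 // => i _.
by rewrite mul0r.
Qed.

Lemma fps_mulDl : left_distributive fps_mul fps_add.
Proof.
move=> f g h; apply: fpsP => n /=; rewrite -big_split /=.
by apply: eq_bigr => i _; rewrite mulrDl.
Qed.

Lemma fps_one_neq0 : fpsC 1 != 0.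
Proof.
by apply/eqP => /(congr1 (fun f : fps R => f 0)) /eqP; rewrite oner_eq0.
Qed.

HB.instance Definition _ := GRing.Zmodule_isComNzRing.Build (fps R)
  fps_mulA fps_mulC fps_mul1 fps_mulDl fps_one_neq0.

Definition fps_unit : pred (fps R) := fun f => `[< exists g, g * f = 1 >].

Definition fps_inv f : fps R :=
  if pselect (exists g, g * f = 1) is left ex then sval (cid ex) else f.

Lemma fps_mulVx : {in fps_unit, left_inverse 1 fps_inv *%R}.
Proof.
move=> f /asboolP exf; rewrite /fps_inv; case: pselect => // ex.
by case: (cid ex).
Qed.

Lemma fps_unitPl f g : g * f = 1 -> fps_unit f.
Proof. by move=> gf1; apply/asboolP; exists g. Qed.

Lemma fps_inv_out : {in [predC fps_unit], fps_inv =1 id}.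
Proof.
move=> f; rewrite inE => /asboolP nex.
by rewrite /fps_inv; case: pselect.
Qed.

HB.instance Definition _ := GRing.ComNzRing_hasMulInverse.Build (fps R)
  fps_mulVx fps_unitPl fps_inv_out.

End FpsRing.

Section FpsIntegral.
Variable R : idomainType.

Lemma fps_lead (f : fps R) : f != 0 ->
  exists2 n, f n != 0 & forall k, (k < n)%N -> f k = 0.
Proof.
move=> f0; have ex : exists n, f n != 0.
  apply: contrapT => nex; case/eqP: f0; apply: fpsP => n.
  by apply/eqP/negPn/negP => fn; apply: nex; exists n.
exists (ex_minn ex); case: ex_minnP => n fn min //.
move=> k kn; apply/eqP/negPn/negP => /min; by rewrite leqNgt kn.
Qed.

Lemma fps_integral (f g : fps R) : f * g = 0 -> (f == 0) || (g == 0).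
Proof.
move=> fg0; apply/norP => -[/fps_lead[i fi mini] /fps_lead[j gj minj]].
have /eqP := congr1 (fun h : fps R => h (i + j)%N) fg0.
have i_lt : (i < (i + j).+1)%N by rewrite ltnS leq_addr.
rewrite /= (bigD1 (Ordinal i_lt)) //= addKn big1 => [|k ki].
  by rewrite addr0 mulf_eq0 (negPf fi) (negPf gj).
have [/mini->|ik] := ltnP k i; first by rewrite mul0r.
have {}ik : (i < k)%N by rewrite ltn_neqAle ik eq_sym andbT.
rewrite minj ?mulr0 // ltn_subLR; first by rewrite ltn_add2r.
by rewrite -ltnS.
Qed.

HB.instance Definition _ :=
  GRing.ComUnitRing_isIntegral.Build (fps R) fps_integral.

End FpsIntegral.

(* A rooted tree on the vertex set [V] is given by its root and by the map
   sending a vertex to the end of its outgoing edge.  The root has no outgoing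
   edge; by convention it is mapped to itself. *)
Definition is_rooted_tree (V : finType) (d : V * {ffun V -> V}) : bool :=
  (d.2 d.1 == d.1) && [forall v, fconnect d.2 v d.1].

Record tree_on (V : finType) :=
  TreeOn { tree_data : V * {ffun V -> V}; _ : is_rooted_tree tree_data }.

HB.instance Definition _ (V : finType) := [isSub for @tree_data V].
HB.instance Definition _ (V : finType) := [Choice of tree_on V by <:].

Definition root (V : finType) (T : tree_on V) : V := (tree_data T).1.
Definition parent (V : finType) (T : tree_on V) : {ffun V -> V} :=
  (tree_data T).2.

Definition child (V : finType) (T : tree_on V) (w v : V) : bool :=
  (w != root T) && (parent T w == v).

Definition tree_iso (V W : finType) (T : tree_on V) (U : tree_on W)
    (f : {ffun V -> W}) : bool :=
  [&& injectiveb f, [forall y, y \in codom f], f (root T) == root U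
    & [forall w, forall v, child U (f w) (f v) == child T w v]].

Definition aut (V : finType) (T : tree_on V) : nat :=
  #|[pred f | tree_iso T T f]|.

(* Up to isomorphism, the vertex set may be taken to be some ['I_n]. *)
Definition rtree : Type := {n : nat & tree_on 'I_n}.

Definition isomorphic (T U : rtree) : bool :=
  [exists f, tree_iso (tagged T) (tagged U) f].

Lemma tree_isoP (V W : finType) (T : tree_on V) (U : tree_on W)
    (f : {ffun V -> W}) :
  reflect [/\ bijective f, f (root T) = root U
            & forall w v, child U (f w) (f v) = child T w v]
          (tree_iso T U f).
Proof.
apply: (iffP and4P) => [[/injectiveP f_inj /forallP f_surj /eqP f_root f_ch]|].
  split=> //; last by move=> w v; apply/eqP; apply: (forallP (forallP f_ch w)).
  apply: inj_card_bij => //; rewrite -(card_codom f_inj).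
  by apply/subset_leq_card/fintype.subsetP => y _; apply: f_surj.
move=> [[g gK fK] f_root f_ch]; split; last 2 first.
- exact/eqP.
- by apply/forallP => w; apply/forallP => v; rewrite f_ch.
- exact/injectiveP/(can_inj gK).
- by apply/forallP => y; rewrite -(fK y) codom_f.
Qed.

Lemma isomorphic_refl : reflexive isomorphic.
Proof.
move=> T; apply/existsP; exists [ffun x => x]; apply/tree_isoP; split.
- by exists [ffun x => x] => x; rewrite !ffunE.
- by rewrite ffunE.
- by move=> w v; rewrite !ffunE.
Qed.

Lemma isomorphic_symW T U : isomorphic T U -> isomorphic U T.
Proof.
move=> /existsP[f /tree_isoP[[g fK gK] f_root f_ch]].
apply/existsP; exists (finfun g); apply/tree_isoP; split.
- by exists f => x; rewrite ffunE.
- by rewrite ffunE -f_root fK.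
- by move=> w v; rewrite !ffunE -f_ch !gK.
Qed.

Lemma isomorphic_sym : symmetric isomorphic.
Proof. by move=> T U; apply/idP/idP; apply: isomorphic_symW. Qed.

Lemma isomorphic_trans : transitive isomorphic.
Proof.
move=> U T S /existsP[f /tree_isoP[bf f_root f_ch]].
move=> /existsP[g /tree_isoP[bg g_root g_ch]].
apply/existsP; exists [ffun x => g (f x)]; apply/tree_isoP; split.
- by apply: (eq_bij (bij_comp bg bf)) => x; rewrite ffunE.
- by rewrite ffunE f_root.
- by move=> w v; rewrite !ffunE g_ch f_ch.
Qed.

Canonical isomorphic_equiv :=
  EquivRel isomorphic isomorphic_refl isomorphic_sym isomorphic_trans.

Definition tree_class : Type := {eq_quot isomorphic}.

Section Flows.
Variables (V : finType) (T : tree_on V).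

Section Rate.
Variables (O : {set V}) (m : {ffun V -> nat}).

(* The recursion on the tree is bounded by the fuel [n]; the fuel [#|V|] is
   always sufficient, see [rateE] and [rate_unique]. *)
Fixpoint rate_rec (n : nat) (v : V) : int :=
  if n is n'.+1 then
    (m v)%:Z - (v \in O)%:Z + \sum_(w | child T w v) rate_rec n' w
  else 0.

Definition rate (v : V) : int := rate_rec #|V| v.

Lemma fconnect_root v : fconnect (parent T) v (root T).
Proof.
by case/andP: (valP T) => _ /forallP; apply.
Qed.

Lemma parent_root : parent T (root T) = root T.
Proof. by case/andP: (valP T) => /eqP. Qed.

Lemma fconnect_child w v : child T w v -> ~~ fconnect (parent T) v w.
Proof.
move=> /andP[w_nroot /eqP wv]; apply/negP => /iter_findex vw.
have iter_root k : iter k (parent T) (root T) = root T.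
  by elim: k => //= k ->; rewrite parent_root.
set k := findex _ _ _ in vw.
have loop j : iter (j * k.+1) (parent T) w = w.
  by elim: j => // j IH; rewrite mulSn iterD IH iterSr wv vw.
have := fconnect_root w => /iter_findex; set l := findex _ _ _ => wr.
case/eqP: w_nroot; rewrite -(loop l) mulnS addnC iterD wr; exact: iter_root.
Qed.

Definition subtree v : {set V} := [set w | fconnect (parent T) w v].

Lemma subtree_child w v : child T w v -> (#|subtree w| < #|subtree v|)%N.
Proof.
move=> wv; apply/proper_card/properP; split.
  apply/fintype.subsetP => x; rewrite !inE => xw; apply: connect_trans xw _.
  by case/andP: wv => _ /eqP <-; apply: fconnect1.
exists v; first by rewrite inE connect0.
by rewrite inE; apply: fconnect_child.
Qed.

Lemma rate_rec_fuel n p v :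
  (#|subtree v| <= n)%N -> (#|subtree v| <= p)%N -> rate_rec n v = rate_rec p v.
Proof.
have pos u : (0 < #|subtree u|)%N.
  by apply/card_gt0P; exists u; rewrite inE connect0.
elim: n p v => [|n IH] [|p] v.
- by rewrite leqNgt pos.
- by rewrite leqNgt pos.
- by move=> _; rewrite leqNgt pos.
move=> vn vp /=; congr (_ + _); apply: eq_bigr => w wv.
by apply: IH; rewrite -ltnS (leq_trans (subtree_child wv)).
Qed.

Lemma rateE v :
  rate v = (m v)%:Z - (v \in O)%:Z + \sum_(w | child T w v) rate w.
Proof.
have -> : rate v = rate_rec #|V|.+1 v.
  by apply: rate_rec_fuel; rewrite ?leqW // max_card.
by [].
Qed.

Lemma rate_unique (r : V -> int) :
    (forall v, r v = (m v)%:Z - (v \in O)%:Z + \sum_(w | child T w v) r w) ->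
  forall v, r v = rate v.
Proof.
move=> rE v; have [n] := ubnP #|subtree v|; elim: n v => // n IH v.
rewrite ltnS => vn; rewrite rE rateE; congr (_ + _); apply: eq_bigr => w wv.
by apply: IH; apply: leq_trans (subtree_child wv) vn.
Qed.

End Rate.

(* Candidate flows: the set of outputs and the multiplicities of the inputs. *)
Definition preflow : Type := ({set V} * {ffun V -> nat})%type.

Definition is_flow (F : preflow) : bool :=
  [forall v in F.1, F.2 v == 0%N] && [forall v, 0 <= rate F.1 F.2 v].

Definition flow_size (F : preflow) : nat := #|F.1|.

Definition exit_rate (F : preflow) : int := rate F.1 F.2 (root T).

Definition is_small (F : preflow) : bool :=
  (root T \notin F.1) && (F.2 (root T) == 0%N).

Lemma rate_bound F k v :
    is_flow F -> iter k (parent T) v = root T ->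
  rate F.1 F.2 v <= exit_rate F + k%:Z.
Proof.
move=> /andP[_ /forallP r_ge0]; elim: k v => [|k IH] v.
  by move=> /= ->; rewrite addr0.
rewrite iterSr; have [->|v_nroot] := eqVneq v (root T).
  by move=> _; rewrite lerDl.
move=> /IH; have vp : child T v (parent T v) by rewrite /child v_nroot eqxx.
rewrite [in X in X -> _]rateE (bigD1 v vp) /= => le_k.
have sum_ge0 :
  0 <= \sum_(w | child T w (parent T v) && (w != v)) rate F.1 F.2 w.
  by apply: sumr_ge0.
by move: le_k sum_ge0; move: (\sum_(_ | _) _) => s; case: (_ \in _) => /=; lia.
Qed.

Lemma finite_flows (n : nat) :
  finite_set [set F | is_flow F /\ exit_rate F = n%:Z]%classic.
Proof.
pose N := (n + #|V|).+2.
pose h (G : {set V} * {ffun V -> 'I_N}) : preflow :=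
  (G.1, [ffun v => nat_of_ord (G.2 v)]).
apply: (sub_finite_set (B := [set h G | G in [set: _]]%classic)); last first.
  exact/finite_image/finite_finset.
move=> [O m] [Ff Fn]; exists (O, [ffun v => inord (m v)]) => //.
rewrite /h /=; congr pair; apply/ffunP => v; rewrite !ffunE inordK //.
have /iter_findex rv := fconnect_root v.
have := rate_bound Ff rv; rewrite Fn rateE /=.
move=> le2; have /andP[_ /forallP r_ge0] := Ff.
have S_ge0 : 0 <= \sum_(w | child T w v) rate O m w by apply: sumr_ge0.
have : (findex (parent T) v (root T) <= #|V|)%N.
  apply: ltnW; apply: leq_trans (max_card (fconnect (parent T) v)).
  exact/findex_max/fconnect_root.
move: le2 S_ge0; move: (\sum_(_ | _) _) => s; rewrite /N.
by case: (_ \in _) => /=; lia.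
Qed.

(* The sum of [b ^ size * t ^ exit_rate] over the flows satisfying [P], as an
   element of [Q[b][[t]]] with ['X] for [b].  A [\sum_(_ \in _)] over an
   infinite support would be [0] by convention: [finite_flows] excludes this. *)
Definition flow_gf (P : pred preflow) : fps {poly rat} :=
  FPS (fun n =>
    \sum_(F \in [set F | [/\ is_flow F, P F & exit_rate F = n%:Z]]%classic)
      ('X^(flow_size F) : {poly rat})).

End Flows.

Definition flow_tree_gf (V : finType) (T : tree_on V) : fps {poly rat} :=
  flow_gf T predT.
Definition small_flow_tree_gf (V : finType) (T : tree_on V) : fps {poly rat} :=
  flow_gf T (is_small T).

(* The generating series of a tree depends only on its isomorphism class. *)
Section Invariance.
Variables (V W : finType) (T : tree_on V) (U : tree_on W).
Variables (f : {ffun V -> W}) (g : W -> V).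
Hypotheses (fK : cancel f g) (gK : cancel g f).
Hypothesis f_root : f (root T) = root U.
Hypothesis f_child : forall w v, child U (f w) (f v) = child T w v.

Let move_flow (F : preflow V) : preflow W :=
  (finset (fun y => g y \in F.1), [ffun y => F.2 (g y)]).

Lemma rate_rec_iso F n v :
  rate_rec U (move_flow F).1 (move_flow F).2 n (f v) = rate_rec T F.1 F.2 n v.
Proof.
elim: n v => //= n IH v; rewrite ffunE inE fK; congr (_ + _).
rewrite (reindex f) /=; last by exists g => x _.
by apply: eq_big => [w|w _]; rewrite ?f_child ?IH.
Qed.

Lemma rate_iso F v :
  rate U (move_flow F).1 (move_flow F).2 (f v) = rate T F.1 F.2 v.
Proof.
have VW : #|W| = #|V| by apply/esym/bij_eq_card; exists g; [exact: fK|].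
by rewrite /rate VW rate_rec_iso.
Qed.

Lemma is_flow_iso F : is_flow U (move_flow F) = is_flow T F.
Proof.
congr (_ && _); apply/forallP/forallP => H x.
- by have := H (f x); rewrite inE ffunE fK.
- by rewrite inE ffunE.
- by rewrite -rate_iso.
- by rewrite -(gK x) rate_iso.
Qed.

Lemma exit_rate_iso F : exit_rate U (move_flow F) = exit_rate T F.
Proof. by rewrite /exit_rate -f_root rate_iso. Qed.

Lemma is_small_iso F : is_small U (move_flow F) = is_small T F.
Proof. by rewrite /is_small inE ffunE -f_root fK. Qed.

Lemma flow_size_iso F : flow_size (move_flow F) = flow_size F.
Proof.
have f_inj := can_inj fK.
rewrite /flow_size -[RHS](card_imset _ f_inj); apply: eq_card => y.
rewrite inE; apply/idP/imsetP => [gy|[x xF ->]]; last by rewrite fK.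
by exists (g y).
Qed.

Lemma flow_gf_iso (P : pred (preflow V)) (Q : pred (preflow W)) :
  (forall F, Q (move_flow F) = P F) -> flow_gf T P = flow_gf U Q.
Proof.
move=> PQ; apply: fpsP => n /=.
pose back (G : preflow W) : preflow V :=
  (finset (fun x => f x \in G.1), [ffun x => G.2 (f x)]).
have moveK : cancel move_flow back.
  move=> [O m]; congr pair; first by apply/setP => x; rewrite !inE fK.
  by apply/ffunP => x; rewrite !ffunE fK.
have backK : cancel back move_flow.
  move=> [O m]; congr pair; first by apply/setP => x; rewrite !inE gK.
  by apply/ffunP => x; rewrite !ffunE gK.
under [LHS]eq_fsbigr => F _ do rewrite -flow_size_iso.
apply/esym; apply: reindex_fsbig; split.
- by move=> F [FT PF <-]; rewrite /= is_flow_iso PQ exit_rate_iso.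
- by move=> F G _ _; apply: (can_inj moveK).
- move=> G [GU QG Gn]; exists (back G); rewrite ?backK //.
  by split; rewrite -?is_flow_iso -?PQ -?exit_rate_iso backK.
Qed.

End Invariance.

Lemma flow_tree_gf_iso (T U : rtree) : isomorphic T U ->
  flow_tree_gf (tagged T) = flow_tree_gf (tagged U).
Proof.
move=> /existsP[f /tree_isoP[[g fK gK] f_root f_child]].
exact: (flow_gf_iso fK gK).
Qed.

Lemma small_flow_tree_gf_iso (T U : rtree) : isomorphic T U ->
  small_flow_tree_gf (tagged T) = small_flow_tree_gf (tagged U).
Proof.
move=> /existsP[f /tree_isoP[[g fK gK] f_root f_child]].
by apply: (flow_gf_iso fK gK f_root f_child) => F; apply: is_small_iso.
Qed.

(* [\sum_T G T * T / aut T], as the family of its coefficients. *)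
Definition tree_sum (G : forall V : finType, tree_on V -> fps {poly rat}) :
    tree_class -> fps {poly rat} :=
  fun c => let T := tagged (repr c) in G _ T / (aut T)%:R.

Definition flow_series : tree_class -> fps {poly rat} :=
  tree_sum flow_tree_gf.
Definition small_flow_series : tree_class -> fps {poly rat} :=
  tree_sum small_flow_tree_gf.
Definition small_flow_series0 : tree_class -> {poly rat} :=
  fun c => small_flow_series c 0%N.

Lemma fpsC_nat (R : comNzRingType) n : n%:R = fpsC n%:R :> fps R.
Proof.
elim: n => [|n IH]; first by apply: fpsP => -[].
by rewrite -natr1 IH; apply: fpsP => -[|k] /=; rewrite ?natr1 ?addr0.
Qed.

Lemma aut_unit (V : finType) (T : tree_on V) :
  ((aut T)%:R : fps {poly rat}) \is a GRing.unit.
Proof.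
have aut_gt0 : (0 < aut T)%N.
  apply/card_gt0P; exists [ffun x => x]; rewrite inE; apply/tree_isoP; split.
  - by exists [ffun x => x] => x; rewrite !ffunE.
  - by rewrite ffunE.
  - by move=> w v; rewrite !ffunE.
apply/unitrPr; exists (fpsC ((aut T)%:R^-1)%:P); rewrite fpsC_nat.
apply: fpsP => -[|n] /=.
  rewrite big_ord1 /= -polyC_natr -polyCM mulfV ?pnatr_eq0 -?lt0n //.
by rewrite big1 // => -[[|i] /= _] _; rewrite ?mulr0 ?mul0r.
Qed.

(* The field of fractions of [Q[b][[t]]], where one can divide by [t]. *)
Definition Kbt : fieldType := {fraction fps {poly rat}}.
Definition b : Kbt := tofrac (fpsC 'X).
Definition t : Kbt := tofrac (fpsX {poly rat}).

Definition embed_fps (s : tree_class -> fps {poly rat}) : tree_class -> Kbt^o :=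
  fun c => tofrac (s c).
Definition embed_poly (s : tree_class -> {poly rat}) : tree_class -> Kbt^o :=
  fun c => tofrac (fpsC (s c)).

(* Main.v *)
Require Import Defs.
From HB Require Import structures.
From mathcomp Require Import all_boot all_order all_algebra.
From mathcomp Require Import boolp classical_sets functions cardinality fsbigop.
From mathcomp Require Import zify ring.

Set Implicit Arguments.
Unset Strict Implicit.
Unset Printing Implicit Defensive.

Import GRing.Theory Num.Theory.
(* Here [root] is the root of a tree, not the predicate on polynomials. *)
Import Defs.

Local Open Scope ring_scope.

(** The weight [1 / aut T] is a constant, so the identity holds as soon as it
    holds for each tree [T] separately. There the point is that the root has no
    influence on the rate of any other vertex ([rate_set_root]): the outputs and
    inputs at the root may be changed freely, as long as the root is not both an
    output and an input and the exit rate stays nonnegative.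

    If the root is not an output, the flow is a small flow together with an
    arbitrary number [j] of inputs at the root, which adds [j] to the exit rate;
    summing over [j] gives [D_t / (1 - t)]. This is used in the form
    [N = D_t + t * N], obtained by removing one input at a time
    ([flow_gf_no_root_output]). If the root is an output, forgetting it leaves
    a small flow with one output less and exit rate one higher; the small flows
    so obtained are those of positive exit rate, which gives
    [b / t * (D_t - D)] ([flow_gf_root_output]). *)

(** * Formal power series *)

Lemma fps_mulE (R : comNzRingType) (f g : fps R) n :
  (f * g) n = \sum_(i < n.+1) f i * g (n - i)%N.
Proof. by []. Qed.

Lemma fpsCM (R : comNzRingType) (c : R) (f : fps R) n : (fpsC c * f) n = c * f n.
Proof.
rewrite fps_mulE big_ord_recl /= subn0 big1 ?addr0 // => i _.
by rewrite mul0r.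
Qed.

Lemma fpsXM (R : comNzRingType) (f : fps R) n :
  (fpsX R * f) n = if n is n'.+1 then f n' else 0.
Proof.
rewrite fps_mulE; case: n => [|n]; first by rewrite big_ord1 mul0r.
rewrite big_ord_recl big_ord_recl /= mul0r add0r mul1r subn1 big1 ?addr0 //.
by move=> i _; rewrite mul0r.
Qed.

Lemma fpsC_const_mul (R : comNzRingType) (f g : fps R) :
  fpsC ((f * g) 0%N) = fpsC (f 0%N) * fpsC (g 0%N).
Proof.
by apply: fpsP => -[|n]; rewrite fpsCM /= ?mulr0 // big_ord1.
Qed.

(** Taking the constant term is multiplicative, and the quantity divided by is
    its own constant term. *)
Lemma fpsC_const_divr_nat (R : comNzRingType) (f : fps R) (k : nat) :
  (k%:R : fps R) \is a GRing.unit ->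
  fpsC ((f / k%:R) 0%N) = fpsC (f 0%N) / k%:R.
Proof.
move=> k_unit; apply: (canRL (mulrK k_unit)).
have kE : (k%:R : fps R) = fpsC ((k%:R : fps R) 0%N) by rewrite fpsC_nat.
by rewrite [X in _ * X]kE -fpsC_const_mul divrK.
Qed.

(** * Changing a flow at the root *)

Section RootChange.
Context {V : finType} (T : tree_on V).
Implicit Types F : preflow V.

Definition set_root F (o : bool) (j : nat) : preflow V :=
  (if o then root T |: F.1 else F.1 :\ root T,
   [ffun v => if v == root T then j else F.2 v]).

Definition root_inflow F : int :=
  \sum_(w | child T w (root T)) rate T F.1 F.2 w.

Lemma in_set_root F o j v :
  (v \in (set_root F o j).1) = if v == root T then o else v \in F.1.
Proof. by rewrite /set_root /=; case: o; rewrite !inE; case: (v == root T). Qed.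

Lemma set_root_input F o j v :
  (set_root F o j).2 v = if v == root T then j else F.2 v.
Proof. exact: ffunE. Qed.

Lemma set_root_id F o j :
  (root T \in F.1) = o -> F.2 (root T) = j -> set_root F o j = F.
Proof.
move=> Fo Fj; rewrite [RHS]surjective_pairing; congr pair; last first.
  by apply/ffunP => v; rewrite (set_root_input _ o); have [->|] := eqVneq v (root T).
by apply/setP => v; rewrite (in_set_root _ _ j); have [->|] := eqVneq v (root T).
Qed.

Lemma set_rootK F o j o' j' :
  set_root (set_root F o j) o' j' = set_root F o' j'.
Proof.
rewrite [LHS]surjective_pairing [RHS]surjective_pairing; congr pair.
  apply/setP => v; rewrite (in_set_root _ _ j') (in_set_root _ _ j') in_set_root.
  by case: (v == root T).
by apply/ffunP => v; rewrite !ffunE; case: (v == root T).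
Qed.

Lemma flow_size_set_root F o j :
  flow_size (set_root F o j) = (o + #|F.1 :\ root T|)%N.
Proof.
rewrite /flow_size /=; case: o => //.
rewrite (cardsD1 (root T)) setU11; congr (_ + _)%N; apply: eq_card => v.
by rewrite !inE; case: (v == root T).
Qed.

Lemma flow_sizeE F :
  flow_size F = ((root T \in F.1) + #|F.1 :\ root T|)%N.
Proof. exact: cardsD1. Qed.

(** Flow runs towards the root, so the root has no influence upstream. *)
Lemma rate_set_root F o j v : v != root T ->
  rate T (set_root F o j).1 (set_root F o j).2 v = rate T F.1 F.2 v.
Proof.
have := set_root_input F o j; have := in_set_root F o j.
move: (set_root F o j) => G GO Gm.
rewrite /rate; elim: #|V| v => //= n IH v vr.
rewrite GO Gm (negPf vr); congr (_ + _).
by apply: eq_bigr => w /andP[wr _]; apply: IH.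
Qed.

Lemma exit_rateE F :
  exit_rate T F = (F.2 (root T))%:Z - (root T \in F.1)%:Z + root_inflow F.
Proof. exact: rateE. Qed.

Lemma exit_rate_set_root F o j :
  exit_rate T (set_root F o j) = j%:Z - o%:Z + root_inflow F.
Proof.
rewrite exit_rateE in_set_root set_root_input eqxx; congr (_ + _).
by apply: eq_bigr => w /andP[wr _]; apply: rate_set_root.
Qed.

Lemma is_flow_set_root F o j :
    is_flow T F -> (is_true o -> j = 0%N) -> 0 <= exit_rate T (set_root F o j) ->
  is_flow T (set_root F o j).
Proof.
move=> /andP[/forallP Fin /forallP Fr] oj exit_ge0.
apply/andP; split; apply/forallP => v; last first.
  have [->|vr] := eqVneq v (root T); first exact: exit_ge0.
  by rewrite rate_set_root.
rewrite in_set_root set_root_input; case: ifP => _; last exact: Fin.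
by apply/implyP => /oj ->.
Qed.

End RootChange.

(** * Generating series of flows on one tree *)

Section FlowSeries.
Context {V : finType} (T : tree_on V).
Implicit Types (F : preflow V) (P Q : pred (preflow V)).

Local Notation D := (small_flow_tree_gf T).

Lemma flow_gfID (A P : pred (preflow V)) :
  flow_gf T P = flow_gf T (predI P A) + flow_gf T (predD P A).
Proof.
apply: fpsP => n /=; rewrite (fsbigID [set F | A F]%classic); last first.
  by apply: sub_finite_set (finite_flows T n) => F [].
congr (_ + _); apply: eq_fsbigl; apply/predeqP => F /=; split.
- by move=> [[FT PF Fn] AF]; split=> //; apply/andP.
- by move=> [FT /andP[PF AF] Fn].
- by move=> [[FT PF Fn] /negP AF]; split=> //; apply/andP.
- by move=> [FT /andP[/negP AF PF] Fn].
Qed.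

(** How bijections between families of flows are turned into identities of
    series: [k] is the number of outputs that [phi] creates, whereas the change
    of exit rate from [n] to [p] is left to the comparison of coefficients. *)
Lemma flow_gf_coef_bij P Q (phi psi : preflow V -> preflow V) n p k :
    (forall F, is_flow T F -> P F -> exit_rate T F = n%:Z ->
       [/\ is_flow T (phi F), Q (phi F), exit_rate T (phi F) = p%:Z,
           flow_size (phi F) = (k + flow_size F)%N & psi (phi F) = F]) ->
    (forall G, is_flow T G -> Q G -> exit_rate T G = p%:Z ->
       [/\ is_flow T (psi G), P (psi G), exit_rate T (psi G) = n%:Z
         & phi (psi G) = G]) ->
  flow_gf T Q p = 'X^k * flow_gf T P n.
Proof.
move=> phiP psiP; rewrite /= mulr_fsumr.
rewrite (reindex_fsbig phi
  [set F | [/\ is_flow T F, P F & exit_rate T F = n%:Z]]%classic).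
  apply: eq_fsbigr => F; rewrite inE /= => -[FT PF Fn].
  by have [_ _ _ -> _] := phiP F FT PF Fn; rewrite exprD.
split.
- by move=> F [FT PF Fn]; have [] := phiP F FT PF Fn.
- move=> F G; rewrite !inE /= => -[FT PF Fn] [GT PG Gn] eqFG.
  have [_ _ _ _ <-] := phiP F FT PF Fn; rewrite eqFG.
  by have [] := phiP G GT PG Gn.
- by move=> G [GT QG Gp]; have [? ? ? ?] := psiP G GT QG Gp; exists (psi G).
Qed.

Definition root_output F : bool := root T \in F.1.
Definition root_input F : bool := (0 < F.2 (root T))%N.

Lemma eq_flow_gf P Q : (forall F, is_flow T F -> P F = Q F) ->
  flow_gf T P = flow_gf T Q.
Proof.
move=> PQ; apply: fpsP => n; apply: eq_fsbigl; apply/predeqP => F /=.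
by split=> -[FT PF Fn]; split; rewrite // ?PQ // -PQ.
Qed.

(** Deleting one unit of input at the root lowers the exit rate by one and
    leaves an arbitrary flow whose root is not an output; this is where the
    geometric series in [t] comes from. *)
Lemma flow_gf_root_input :
  flow_gf T (predI (predC root_output) root_input)
  = fpsX _ * flow_gf T (predC root_output).
Proof.
apply: fpsP => -[|n]; rewrite fpsXM.
  (* With no output at the root, the exit rate is at least the input there. *)
  apply: fsbig1 => F [/andP[_ /forallP Fr] /andP[/negPf Fo Fi]].
  move: Fo Fi; rewrite /root_output /root_input exit_rateE => -> Fi.
  have : 0 <= root_inflow T F by apply: sumr_ge0.
  by move: Fi; lia.
rewrite (flow_gf_coef_bij (P := predC root_output) (n := n) (k := 0)
  (phi := fun F => set_root T F false (F.2 (root T)).+1)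
  (psi := fun F => set_root T F false (F.2 (root T)).-1)).
- by rewrite expr0 mul1r.
- move=> F FT /negbTE; rewrite /root_output exit_rateE => Fo; rewrite Fo => Fn.
  have Gn : exit_rate T (set_root T F false (F.2 (root T)).+1) = n.+1%:Z.
    by rewrite exit_rate_set_root; lia.
  split=> //.
  + by apply: is_flow_set_root; rewrite // Gn.
  + by rewrite /= /root_output /root_input /= setD11 ffunE eqxx.
  + by rewrite flow_size_set_root (flow_sizeE T F) Fo.
  + by rewrite set_rootK set_root_input eqxx set_root_id // Fo.
- move=> F FT /andP[/negbTE]; rewrite /root_output /root_input exit_rateE.
  move=> Fo Fi; rewrite Fo => Fn.
  have Gn : exit_rate T (set_root T F false (F.2 (root T)).-1) = n%:Z.
    by rewrite exit_rate_set_root; lia.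
  split=> //.
  + by apply: is_flow_set_root; rewrite // Gn.
  + by rewrite /= /root_output /= setD11.
  + by rewrite set_rootK set_root_input eqxx set_root_id ?prednK // Fo.
Qed.

Lemma flow_gf_no_root_output :
  flow_gf T (predC root_output) = D + fpsX _ * flow_gf T (predC root_output).
Proof.
rewrite {1}(flow_gfID root_input) -flow_gf_root_input addrC; congr (_ + _).
by apply: eq_flow_gf => F _; rewrite /= /root_input lt0n negbK andbC.
Qed.

(** Making the root of a small flow an output lowers the exit rate by one,
    which is possible exactly when that rate is positive: hence the removal of
    the constant term and the factor [b / t]. *)
Lemma flow_gf_root_output :
  fpsX _ * flow_gf T root_output = fpsC 'X * (D - fpsC (D 0%N)).
Proof.
apply: fpsP => -[|n]; rewrite fpsXM fpsCM.
  by rewrite (_ : (D - _) 0%N = D 0%N - D 0%N) // subrr mulr0.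
rewrite (_ : (D - _) n.+1 = D n.+1 - 0) // subr0.
rewrite (flow_gf_coef_bij (P := is_small T) (n := n.+1) (k := 1)
  (phi := fun F => set_root T F true 0)
  (psi := fun F => set_root T F false 0)) //.
- move=> F FT /andP[Fo /eqP Fi]; rewrite exit_rateE (negPf Fo) Fi => Fn.
  have Gn : exit_rate T (set_root T F true 0) = n%:Z.
    by rewrite exit_rate_set_root; lia.
  split=> //.
  + by apply: is_flow_set_root; rewrite // Gn.
  + by rewrite /root_output in_set_root eqxx.
  + by rewrite flow_size_set_root (flow_sizeE T F) (negPf Fo).
  + by rewrite set_rootK set_root_id // (negPf Fo).
- move=> F FT Fo; rewrite exit_rateE; move: (Fo); rewrite /root_output => ->.
  have Fi : F.2 (root T) = 0%N.
    by have /andP[/forallP/(_ (root T))/implyP/(_ Fo)/eqP] := FT.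
  rewrite Fi => Fn.
  have Gn : exit_rate T (set_root T F false 0) = n.+1%:Z.
    by rewrite exit_rate_set_root; lia.
  split=> //.
  + by apply: is_flow_set_root; rewrite // Gn.
  + by rewrite /is_small in_set_root set_root_input eqxx.
  + by rewrite set_rootK set_root_id.
Qed.

Lemma flow_tree_gf_split :
  flow_tree_gf T = flow_gf T root_output + flow_gf T (predC root_output).
Proof.
rewrite /flow_tree_gf (flow_gfID root_output).
by congr (_ + _); apply: eq_flow_gf => F _; rewrite /= ?andbT.
Qed.

(** Multiplied by [t * (1 - t)], because [t] is not invertible as a series. *)
Lemma flow_tree_gfE :
  fpsX _ * (1 - fpsX _) * flow_tree_gf T
  = fpsX _ * D + (1 - fpsX _) * fpsC 'X * (D - fpsC (D 0%N)).
Proof.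
have ND : (1 - fpsX _) * flow_gf T (predC root_output) = D.
  by rewrite mulrBl mul1r {1}flow_gf_no_root_output addrK.
rewrite flow_tree_gf_split -[_ * fpsC 'X * _]mulrA -flow_gf_root_output -ND.
ring.
Qed.

End FlowSeries.

(** * Division by [t] and [1 - t] *)

Lemma partial_fractions (K : fieldType) (u c e d d0 : K) :
    u != 0 -> 1 - u != 0 ->
    u * (1 - u) * e = u * d + (1 - u) * c * (d - d0) ->
  e = 1 / (1 - u) * d + c / u * (d - d0).
Proof.
move=> u_neq0 u1_neq0 E; apply: (mulfI (mulf_neq0 u_neq0 u1_neq0)).
by rewrite E; field; apply/andP.
Qed.

Theorem theorem3p2 :
  embed_fps flow_series =
    (1 / (1 - t)) *: embed_fps small_flow_series
    + (b / t) *: (embed_fps small_flow_series - embed_poly small_flow_series0).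
Proof.
have pointwise (x y : Kbt) (f g : tree_class -> Kbt^o) c :
  (x *: f + y *: (f - g)) c = x * f c + y * (f c - g c) by [].
apply/funext => c; rewrite pointwise.
rewrite /embed_fps /embed_poly /small_flow_series0.
rewrite /flow_series /small_flow_series /tree_sum.
set T := tagged (repr c); set a := (aut T)%:R.
set X := fpsX {poly rat}; set D := small_flow_tree_gf T.
have t_neq0 : t != 0.
  rewrite tofrac_eq0; apply/eqP => /(congr1 (fun f : fps _ => f 1%N)) /eqP.
  by rewrite /= oner_eq0.
have t1_neq0 : 1 - t != 0.
  rewrite -tofrac1 -tofracB tofrac_eq0.
  apply/eqP => /(congr1 (fun f : fps _ => f 0%N)) /eqP.
  by rewrite /= subr0 oner_eq0.
have E : X * (1 - X) * (flow_tree_gf T / a)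
    = X * (D / a) + (1 - X) * fpsC 'X * (D / a - fpsC ((D / a) 0%N)).
  rewrite fpsC_const_divr_nat ?aut_unit // -mulrBl !mulrA -mulrDl.
  by rewrite flow_tree_gfE.
move: E; move: (flow_tree_gf T / a) (D / a) => e d /(congr1 (@tofrac _)).
rewrite !(tofracM, tofracB, tofracD, tofrac1) -/t -/b => E.
exact: (partial_fractions t_neq0 t1_neq0 E).
Qed.
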